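(* Let $\lambda \ge \mu$ be infinite cardinals and let $|I| = \lambda$. (1) If $(I, \mathcal{D}, \mathcal{G})$ is $(\lambda, \mu)$-good, $g \in \mathcal{G}$ and $|\mathrm{Range}(g)| \geq \aleph_0$ (without loss of generality $\mathrm{Range}(g) \supseteq \mathbb{N}$), then every ultrafilter $\mathcal{D}_*$ on $I$ extending $\mathcal{D} \cup \{ \{ s \in I : n < g(s) < \omega \} : n < \omega \}$ is not $\mu^+$-flexible, witnessed by $g/\mathcal{D}_*$. (2) More generally, if $\mu \leq \lambda$ is regular, $(I, \mathcal{D}, \mathcal{G})$ is $(\lambda, {<}\mu)$-good, $g \in \mathcal{G}$ and $|\mathrm{Range}(g)| \geq \aleph_0$ (without loss of generality $\mathrm{Range}(g) \supseteq \mathbb{N}$), then every ultrafilter $\mathcal{D}_*$ on $I$ extending $\mathcal{D} \cup \{ \{ s \in I : n < g(s) < \omega \} : n < \omega \}$ is not $\mu$-flexible, witnessed by $g/\mathcal{D}_*$.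
   Context: Regular filter: a filter $\mathcal{D}$ on $I$, $|I|=\lambda$, is regular if there is a family $\langle X_i : i < \lambda\rangle$ of members of $\mathcal{D}$ such that each $t \in I$ lies in only finitely many $X_i$. ''$A = \emptyset \bmod \mathcal{D}$'' means $I \setminus A \in \mathcal{D}$. Good triples: let $\mathcal{D}$ be a regular filter on $I$ and $\mathcal{G}$ a family of functions from $I$ into ordinals. $\mathrm{FI}(\mathcal{G})$ is the set of functions $h$ whose domain is a finite subset of $\mathcal{G}$ and such that $h(g) \in \mathrm{Range}(g)$ for $g \in \mathrm{dom}(h)$. For $h \in \mathrm{FI}(\mathcal{G})$, $A_h = \{ t \in I : g(t) = h(g) \text{ for all } g \in \mathrm{dom}(h)\}$. The triple $(I, \mathcal{D}, \mathcal{G})$ is pre-good if $A_h \neq \emptyset \bmod \mathcal{D}$ for every $h \in \mathrm{FI}(\mathcal{G})$, and it is good if moreover $\mathcal{D}$ is maximal among the filters $\mathcal{D}'$ on $I$ for which $(I, \mathcal{D}', \mathcal{G})$ is pre-good. It is $(\lambda, \mu)$-good if it is good and every $g \in \mathcal{G}$ is a function from $I$ to $\mu$; it is $(\lambda, {<}\mu)$-good if it is good and for every $g \in \mathcal{G}$, $\mathrm{Range}(g)$ is an ordinal $< \mu$. Flexibility: for a cardinal $\chi$, a filter $\mathcal{E}$ on $I$ is $\chi$-flexible if for every $f : I \to \mathbb{N}$ such that $\{t : n < f(t)\} \in \mathcal{E}$ for all $n \in \mathbb{N}$, there are $X_\alpha \in \mathcal{E}$ for $\alpha < \chi$ with $f(t)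 \geq |\{\alpha < \chi : t \in X_\alpha\}|$ for all $t \in I$. ''Not $\chi$-flexible, witnessed by $g/\mathcal{D}_*$'' means that the function $g_*: I \to \mathbb{N}$, with $g_*(s) = g(s)$ if $g(s) < \omega$ and $g_*(s) = 0$ otherwise, satisfies $\{t : n < g_*(t)\} \in \mathcal{D}_*$ for all $n$ but there is no family $\langle X_\alpha : \alpha < \chi\rangle$ of members of $\mathcal{D}_*$ with $g_*(t) \geq |\{\alpha < \chi : t \in X_\alpha\}|$ for all $t \in I$. *)

(* Defs.v *)
From HB Require Import structures.
From mathcomp Require Import all_boot all_order finmap.
From mathcomp Require Import boolp classical_sets functions cardinality filter.

Set Implicit Arguments.
Unset Strict Implicit.
Unset Printing Implicit Defensive.

Local Open Scope classical_set_scope.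
Local Open Scope card_scope.

(* Ordinals are the elements of a totally ordered type O whose strict order is
   well-founded; O is arbitrary, so this covers every set of ordinals.  As a
   set, the ordinal a is its set of predecessors [below a], and a cardinal is
   an initial ordinal. *)
Section Ordinals.
Context {disp : Order.disp_t} {O : orderType disp}.
Implicit Types (a b k : O).

Definition below a : set O := [set x | (x < a)%O].

Definition is_cardinal k := forall a, (a < k)%O -> ~ (below k #<= below a).

Definition is_infinite_cardinal k := is_cardinal k /\ infinite_set (below k).

(* cof k = k for an infinite cardinal k: fewer than k ordinals below k are
   bounded below k. *)
Definition is_regular_cardinal k :=
  is_infinite_cardinal k /\
  forall A : set O, A `<=` below k -> ~ (below k #<= A) ->
    exists2 b, (b < k)%O & forall a, A a -> (a <= b)%O.

Definition lt_omega a := finite_set (below a).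

(* The natural number equal to a if a < omega, and 0 otherwise. *)
Definition nat_part a : nat :=
  if `[< lt_omega a >] then #|` fset_set (below a)| else 0.

End Ordinals.

(* |K| is the least cardinal greater than |A|: every cardinal below |K| is the
   cardinal of some subset B of K. *)
Definition is_successor_cardinal {S T : Type} (A : set S) (K : set T) :=
  ~ (K #<= A) /\ forall B : set T, B `<=` K -> ~ (K #<= B) -> B #<= A.

Definition eq_empty_mod {I : Type} (D : set_system I) (A : set I) := D (~` A).

Section GoodTriples.
Context {disp : Order.disp_t} {O : orderType disp} {I : Type}.
Implicit Types (lam mu : O) (D : set_system I) (G : set (I -> O)).

Definition regular_filter lam D :=
  exists X : O -> set I,
    (forall i, below lam i -> D (X i)) /\
    forall t, finite_set [set i | below lam i /\ X i t].

(* Partial functions on I -> O are option-valued. *)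
Definition pdom (h : (I -> O) -> option O) : set (I -> O) :=
  [set g | h g <> None].

Definition FI G : set ((I -> O) -> option O) :=
  [set h | [/\ finite_set (pdom h), pdom h `<=` G &
               forall g a, h g = Some a -> range g a]].

Definition A_ (h : (I -> O) -> option O) : set I :=
  [set t | forall g a, h g = Some a -> g t = a].

Definition pre_good lam D G :=
  [/\ ProperFilter D, regular_filter lam D &
      forall h, FI G h -> ~ eq_empty_mod D (A_ h)].

Definition good lam D G :=
  pre_good lam D G /\
  forall D', pre_good lam D' G -> D `<=` D' -> D' = D.

(* (lam, mu)-good *)
Definition good_into lam mu D G :=
  good lam D G /\ forall g, G g -> forall t, (g t < mu)%O.

(* (lam, <mu)-good *)
Definition good_into_lt lam mu D G :=
  good lam D G /\
  forall g, G g -> exists2 a, (a < mu)%O & range g = below a.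

End GoodTriples.

Section Flexibility.
Context {I T : Type}.
(* The cardinal chi enters through an index set K with |K| = chi. *)
Implicit Types (K : set T) (E : set_system I) (f : I -> nat).

Definition eventually_large E f := forall n : nat, E [set t | n < f t].

Definition has_bounded_family K E f :=
  exists X : T -> set I,
    (forall i, K i -> E (X i)) /\
    forall t, [set i | K i /\ X i t] #<= `I_(f t).

Definition flexible K E :=
  forall f, eventually_large E f -> has_bounded_family K E f.

Definition witnesses_not_flexible K E f :=
  eventually_large E f /\ ~ has_bounded_family K E f.

End Flexibility.

Definition ultrafilter_above {disp : Order.disp_t} {O : orderType disp}
    {I : Type} (D : set_system I) (g : I -> O) (U : set_system I) :=
  [/\ UltraFilter U, D `<=` U &
      forall n : nat, U [set s | lt_omega (g s) /\ n < nat_part (g s)]].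

(* Main.v *)
(* Maximality of D makes the sets A_h (h in FI(G)) dense modulo D.  If X_i (i in K)
   were members of Dstar with at most g_*(t) of them at each t, pick h_i with
   g in dom(h_i) and A_{h_i} included in X_i modulo D.  As |K|
   exceeds the number of values of the functions in G, a large part of the h_i
   share the value a = h_i(g) and the size of their domain, and a
   chain-condition argument yields a + 1 pairwise compatible ones among them.
   At a common point t of their A_{h_i} and X_i, where g(t) = a, there are too
   many X_i. *)
Require Import Defs.
From mathcomp Require Import all_boot all_order finmap.
From mathcomp Require Import boolp classical_sets functions cardinality filter.

Set Implicit Arguments.
Unset Strict Implicit.
Unset Printing Implicit Defensive.

Import Order.TTheory.
Local Open Scope classical_set_scope.
Local Open Scope card_scope.

(** * Comparison of cardinalities through injections *)

Lemma card_le_inj {T U} (A : set T) (B : set U) (f : T -> U) :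
  (forall x, A x -> B (f x)) ->
  (forall x y, A x -> A y -> f x = f y -> x = y) -> A #<= B.
Proof.
move=> AB finj.
have /card_eqPle[_ /card_le_trans] : f @` A #= A.
  by apply: inj_card_eq => x y /set_mem Ax /set_mem Ay; apply: finj.
by apply; apply: subset_card_le => _ [x Ax <-]; apply: AB.
Qed.

(** The injection is made total, with the default value [u0] outside [A]. *)
Lemma card_le_ex {T U} (u0 : U) (A : set T) (B : set U) : A #<= B ->
  exists f : T -> U, (forall x, A x -> B (f x)) /\
    (forall x y, A x -> A y -> f x = f y -> x = y).
Proof.
move=> /card_leP[f].
exists (fun x => if pselect (x \in A) is left xA then val (f (SigSub xA)) else u0).
split=> [x /mem_set xA|x y /mem_set xA /mem_set yA].
  by case: pselect => // xA'; apply/set_mem/valP.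
case: pselect => // xA'; case: pselect => // yA' /val_inj.
by move=> /(inj (mem_set I) (mem_set I)) [].
Qed.

Lemma card_le_setX {T U T' U'} (u0 : U) (u0' : U')
    (A : set T) (B : set U) (A' : set T') (B' : set U') :
  A #<= B -> A' #<= B' -> A `*` A' #<= B `*` B'.
Proof.
move=> /(card_le_ex u0)[f [fAB finj]] /(card_le_ex u0')[g [gAB ginj]].
apply: (@card_le_inj _ _ _ _ (fun p => (f p.1, g p.2))).
  by move=> [x y] [/= ? ?]; split; [apply: fAB | apply: gAB].
by move=> [x y] [x' y'] [/= Ax Ay] [/= Ax' Ay'] [/finj-> // /ginj->].
Qed.

(** Hilbert's hotel: [x] goes to [j 0], each [j n] moves to [j n.+1], and the rest of [A] stays
    fixed. *)
Lemma card_le_setU1 {T} (x : T) (A : set T) : infinite_set A -> x |` A #<= A.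
Proof.
move=> /infiniteP /(card_le_ex x)[j [jA jinj]].
have {}jinj m n : j m = j n -> m = n by apply: jinj.
have [xA|xA] := pselect (A x).
  by apply: subset_card_le => y [->|].
pose shift y := if pselect (exists n, j n = y) is left e
  then j (projT1 (cid e)).+1 else y.
have shiftj n : shift (j n) = j n.+1.
  rewrite /shift; case: pselect => [e|]; last by case; exists n.
  by case: cid => m /= /jinj->.
have shiftN y : ~ (exists n, j n = y) -> shift y = y.
  by rewrite /shift; case: pselect.
pose f y := if pselect (y = x) then j 0%N else shift y.
have fx : f x = j 0%N by rewrite /f; case: pselect.
have fA y : A y -> f y = shift y.
  by move=> Ay; rewrite /f; case: pselect => // yx; case: xA; rewrite -yx.
have shiftA y : A y -> A (shift y) /\ shift y <> j 0%N.
  move=> Ay; have [[n <-]|yj] := pselect (exists n, j n = y).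
    by rewrite shiftj; split; [apply: jA | move=> /jinj].
  by rewrite shiftN //; split=> // yj0; apply: yj; exists 0%N.
have shift_inj y z : shift y = shift z -> y = z.
  have [[n <-]|yj] := pselect (exists n, j n = y);
    have [[m <-]|zj] := pselect (exists m, j m = z);
    rewrite ?shiftj ?shiftN //.
  - by move=> /jinj[->].
  - by move=> jz; case: zj; exists n.+1.
  - by move=> jy; case: yj; exists m.+1.
apply: (@card_le_inj _ _ _ _ f) => [y [->|Ay]|y z [->|Ay] [->|Az]] //.
- by rewrite fx; apply: jA.
- by rewrite fA //; case: (shiftA y).
- by rewrite fx fA // => /esym; case: (shiftA z).
- by rewrite fx fA //; case: (shiftA y).
- by rewrite !fA // => /shift_inj.
Qed.

(* Send each point, along the well-order, to a value not taken before. *)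
Lemma card_le_wf {X Y} (R : X -> X -> Prop) (P : set X) (W : set Y) (w0 : Y) :
  well_founded R -> (forall p q, [\/ R p q, p = q | R q p]) ->
  (forall p, P p -> ~ (W #<= [set q | P q /\ R q p])) -> P #<= W.
Proof.
move=> Rwf Rtot Psmall.
pose fresh p (f : forall q, R q p -> Y) w :=
  W w /\ forall q (Rqp : R q p), P q -> f q Rqp <> w.
pose step p (f : forall q, R q p -> Y) :=
  if pselect (exists w, fresh p f w) is left e then projT1 (cid e) else w0.
pose f := Fix Rwf (fun=> Y) step.
have fE p : f p = step p (fun q _ => f q).
  apply: Fix_eq => {}p g g' gg'; congr step.
  by apply: functional_extensionality_dep => q; apply/funext => r.
have fP p : P p -> fresh p (fun q _ => f q) (f p).
  (* If no fresh value is left, the values taken at the predecessors of [p] cover [W], against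
     [Psmall]. *)
  move=> Pp; rewrite fE /step; case: pselect => [e|nofresh]; first by case: cid.
  case: (Psmall _ Pp); apply: card_le_trans (card_image_le f _).
  apply: subset_card_le => w Ww; apply: contrapT => wf; apply: nofresh.
  by exists w; split=> // q Rqp Pq fq; apply: wf; exists q.
apply: (@card_le_inj _ _ _ _ f) => [p /fP[]//|p q Pp Pq fpq].
have [Rpq|//|Rqp] := Rtot p q.
  by have [_ /(_ p Rpq Pp)] := fP q Pq.
by have [_ /(_ q Rqp Pq)] := fP p Pp; rewrite fpq.
Qed.

(** * Cardinal arithmetic on initial segments of a well-order *)

Section OrdinalArithmetic.
Context {disp : Order.disp_t} {O : orderType disp}.
Hypothesis O_wf : well_founded (fun x y : O => (x < y)%O).
Implicit Types (a b c k : O).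

Lemma below_le_setU1 b : [set x | (x <= b)%O] = b |` below b.
Proof.
by apply/seteqP; split=> x /=; rewrite le_eqVlt;
  [case/predU1P => [->|]; [left | right] | case=> [->|->]; rewrite ?eqxx ?orbT].
Qed.

Lemma infinite_cardinal_limit k b : is_infinite_cardinal k -> (b < k)%O ->
  ~ (below k #<= [set x | (x <= b)%O]).
Proof.
move=> [k_card k_inf] b_lt_k; rewrite below_le_setU1 => kb.
have [bfin|binf] := pselect (finite_set (below b)).
  by apply: k_inf; apply: card_le_finite kb _; rewrite finite_setU; split.
by apply: (k_card b) => //; apply: card_le_trans kb (card_le_setU1 _ binf).
Qed.

Lemma ex_minimal (P : O -> Prop) : (exists a, P a) ->
  exists2 a, P a & forall b, (b < a)%O -> ~ P b.
Proof.
move=> [a]; elim/(well_founded_ind O_wf): a => a IH Pa.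
have [[b [/IH]]|nob] := pselect (exists b, (b < a)%O /\ P b); first by apply.
by exists a => // b ba Pb; apply: nob; exists b.
Qed.

(** [c] is the least ordinal into whose predecessors [S] injects; leastness makes it initial. *)
Lemma infinite_subset_cardinal (S : set O) m : infinite_set S ->
  S #<= below m ->
  exists c, [/\ is_infinite_cardinal c, (c <= m)%O & S #<= below c].
Proof.
move=> Sinf Sm.
have [c Sc cmin] : exists2 c, S #<= below c &
    forall b, (b < c)%O -> ~ (S #<= below b).
  by apply: (ex_minimal (P := fun c => S #<= below c)); exists m.
exists c; split=> //; last by case: leP => // /cmin.
split=> [a /cmin Sa ca|cfin]; first by apply: Sa; apply: card_le_trans Sc ca.
by apply: Sinf; apply: card_le_finite Sc cfin.
Qed.

Definition godel_lt (p q : O * O) :=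
  let m p := Order.max p.1 p.2 in
  (m p < m q)%O \/ m p = m q /\
    ((p.1 < q.1)%O \/ p.1 = q.1 /\ (p.2 < q.2)%O).

(** Three nested well-founded inductions, on the maximum, the first and the second coordinate. *)
Lemma godel_lt_wf : well_founded godel_lt.
Proof.
suff acc m a b : Order.max a b = m -> Acc godel_lt (a, b).
  by move=> [a b]; apply: acc.
elim/(well_founded_ind O_wf): m a b => m IHm a.
elim/(well_founded_ind O_wf): a => a IHa b.
elim/(well_founded_ind O_wf): b => b IHb mab.
apply: Acc_intro => -[a' b'] [/=|[/= mm [aa'|[aE bb']]]].
- by rewrite mab => /IHm; apply.
- by apply: IHa => //; rewrite mm.
- by rewrite aE in mm *; apply: IHb; rewrite ?mm.
Qed.

Lemma godel_lt_total p q : [\/ godel_lt p q, p = q | godel_lt q p].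
Proof.
rewrite /godel_lt; case: p q => [a b] [a' b'] /=.
case: (ltgtP (Order.max a b) (Order.max a' b')) => mm; last 1 first.
- case: (ltgtP a a') => aa; last 1 first.
  + case: (ltgtP b b') => bb.
    * by apply: Or31; right; split=> //; right.
    * by apply: Or33; right; split=> //; right.
    * by apply: Or32; rewrite aa bb.
  + by apply: Or31; right; split=> //; left.
  + by apply: Or33; right; split=> //; left.
- by apply: Or31; left.
- by apply: Or33; left.
Qed.

(* Goedel's argument: in the order by maximum first, every proper initial
   segment of [below k `*` below k] lies in the square of some [b < k]. *)
Lemma card_below_square k : is_infinite_cardinal k ->
  below k `*` below k #<= below k.
Proof.
elim/(well_founded_ind O_wf): k => k IH kinfc.
have [k_card k_inf] := kinfc.
apply: (card_le_wf k godel_lt_wf godel_lt_total) => p [pk1 pk2] kseg.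
pose m := Order.max p.1 p.2; pose S := [set x | (x <= m)%O].
have mk : (m < k)%O by rewrite /m gt_max pk1 pk2.
have kSS : below k #<= S `*` S.
  apply: card_le_trans kseg _; apply: subset_card_le => -[a b] [_ ab_lt].
  have : (Order.max a b <= m)%O.
    by case: ab_lt => [/ltW//|[/= -> _]].
  by rewrite ge_max => /andP[].
have [Sfin|Sinf] := pselect (finite_set S).
  by apply: k_inf; apply: card_le_finite kSS _; apply: finite_setX.
have minf : infinite_set (below m).
  move=> mfin; apply: Sinf.
  by rewrite /S below_le_setU1 finite_setU; split=> //; apply: finite_set1.
have Sm : S #<= below m by rewrite /S below_le_setU1; apply: card_le_setU1.
(* The induction hypothesis at [c] puts the square of [S], hence [below k], into [below c] with
   [c < k]. *)
have [c [cinfc cm Sc]] := infinite_subset_cardinal Sinf Sm.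
have ck : (c < k)%O by apply: le_lt_trans cm mk.
apply: (k_card c ck); apply: card_le_trans kSS _.
by apply: card_le_trans (card_le_setX k k Sc Sc) (IH c ck cinfc).
Qed.

(** A point is coded by the index of one piece containing it and its position in that piece; such
    pairs lie in the square of [below k]. *)
Lemma card_bigcup_le {T U} k (V : set U) (F : U -> set T) :
  is_infinite_cardinal k -> V #<= below k ->
  (forall v, V v -> F v #<= below k) -> \bigcup_(v in V) F v #<= below k.
Proof.
move=> kinfc /(card_le_ex k)[i [iV iinj]] Fk.
have /choice[j jP] v : exists j : T -> O, V v ->
    (forall t, F v t -> below k (j t)) /\
    (forall t u, F v t -> F v u -> j t = j u -> t = u).
  have [Vv|nVv] := pselect (V v); last by exists (fun=> k).
  by have [j] := card_le_ex k (Fk v Vv); exists j.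
pose F' := \bigcup_(v in V) F v.
have [F'0|/set0P[t0 [v0 _ _]]] := eqVneq F' set0.
  by rewrite -/F' F'0 card_ge0.
have /choice[w wP] t : exists w, F' t -> V w /\ F w t.
  by have [[v Vv Fvt]|nFt] := pselect (F' t); [exists v | exists v0].
apply: card_le_trans (card_below_square kinfc).
apply: (@card_le_inj _ _ _ _ (fun t => (i (w t), j (w t) t))).
  by move=> t /wP[Vw Fw]; split; [apply: iV | apply: (jP _ Vw).1].
move=> t u /wP[Vt Ft] /wP[Vu Fu] [/(iinj _ _ Vt Vu) wE].
by rewrite -wE; apply: (jP _ Vt).2 => //; rewrite wE.
Qed.

(** Given an injection [j] of [below k] into the union, regularity bounds the preimage of each piece
    by some [b v < k], then bounds all these [b v] by one [c < k], which leaves no room for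
    [below k]. *)
Lemma regular_bigcup k a (F : O -> set O) :
  is_regular_cardinal k -> (a < k)%O ->
  (forall v, below a v -> ~ (below k #<= F v)) ->
  ~ (below k #<= \bigcup_(v in below a) F v).
Proof.
move=> [kinfc kreg] ak Fk /(card_le_ex k)[j [jF jinj]].
have /choice[b bP] v : exists b, below a v ->
    (b < k)%O /\ forall x, below k x -> F v (j x) -> (x <= b)%O.
  have [va|va] := pselect (below a v); last by exists k.
  have [||b bk bP] := kreg [set x | below k x /\ F v (j x)]; first by move=> x [].
    move=> kC; apply: (Fk v va); apply: card_le_trans kC _.
    by apply: (@card_le_inj _ _ _ _ j) => [x []|x y [? _] [? _]] //; apply: jinj.
  by exists b => _; split=> // x kx Fx; apply: bP.
have [|ka|c ck cP] := kreg (b @` below a).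
- by move=> _ [v va <-]; apply: (bP v va).1.
- by apply: (kinfc.1 a ak); apply: card_le_trans ka (card_image_le _ _).
apply: (infinite_cardinal_limit kinfc ck); apply: subset_card_le => x kx.
have [v va Fvx] := jF x kx.
by apply: le_trans ((bP v va).2 x kx Fvx) _; apply: cP; exists v.
Qed.

End OrdinalArithmetic.

(** * A chain condition for large families of finite partial functions *)

Definition compatible {E V} (h h' : E -> option V) :=
  forall e v v', h e = Some v -> h' e = Some v' -> v = v'.

Section LargeFamilies.
Context {T : eqType} {E : choiceType} {V : Type}.
(** Smallness is kept abstract to serve both cases: size at most [mu], and size less than [mu].
    [W e] holds the values possible at coordinate [e]. *)
Variables (small : set T -> Prop) (W : E -> set V).
Hypothesis small_sub : forall A B, A `<=` B -> small B -> small A.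
Hypothesis small0 : small set0.
Hypothesis small1 : forall t, small [set t].
Hypothesis smallU : forall A B, small A -> small B -> small (A `|` B).
Hypothesis small_bigcup : forall e (F : V -> set T),
  (forall v, W e v -> small (F v)) -> small (\bigcup_(v in W e) F v).

Lemma small_seq (U : eqType) (F : U -> set T) (s : seq U) (A : set T) :
  ~ small A -> (forall t, A t -> exists2 u, u \in s & F u t) ->
  exists2 u, u \in s & ~ small (F u).
Proof.
move=> nA AF; apply: contrapT => nex; apply: nA.
have Fs u : u \in s -> small (F u).
  by move=> us; apply: contrapT => nFu; apply: nex; exists u.
elim: s A AF Fs {nex} => [|u s IHs] A AF Fs.
  by apply: small_sub small0 => t /AF[].
apply: (@small_sub _ (F u `|` [set t | exists2 v, v \in s & F v t])).
  move=> t /AF[v]; rewrite inE => /predU1P[->|vs] Fvt; first by left.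
  by right; exists v.
apply: smallU; first by apply: Fs; rewrite mem_head.
by apply: IHs => // v vs; apply: Fs; rewrite inE vs orbT.
Qed.

Variables (h : T -> E -> option V).
Hypothesis hW : forall t e v, h t e = Some v -> W e v.

(** A sequence with disjoint domains is extended greedily. If it is stuck, every other point of [A]
    meets one of finitely many domains, and pigeonhole over these domains, then over the coordinates
    of one of them, gives [e]. *)
Lemma disjoint_or_large_fiber m (A : set T) (d : T -> {fset E}) : ~ small A ->
  (exists s : seq T, [/\ uniq s, size s = m, forall t, t \in s -> A t &
     forall t u e, t \in s -> u \in s -> e \in d t -> e \in d u -> t = u]) \/
  exists e, ~ small [set t | A t /\ e \in d t].
Proof.
move=> nA.
elim: m => [|m [[s [us sm sA sd]]|]]; [by left; exists [::] | | by right].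
have [[x [Ax xs xd]]|nox] := pselect (exists x, [/\ A x, x \notin s &
    forall u e, u \in s -> e \in d x -> e \in d u -> False]).
  left; exists (x :: s); split=> //=; [by rewrite xs | by rewrite sm | |].
    by move=> t; rewrite inE => /predU1P[->|/sA].
  move=> t u e; rewrite !inE => /predU1P[->|ts] /predU1P[->|us'] //.
  - by move=> ex eu; case: (xd u e).
  - by move=> et ex; case: (xd t e).
  - exact: sd.
right; pose F u := [set t | A t /\ (t = u \/ exists2 e, e \in d t & e \in d u)].
have [|u us' nFu] := @small_seq _ F s A nA.
  move=> t At; apply: contrapT => nF; apply: nox; exists t; split=> //.
    by apply/negP => ts; apply: nF; exists t => //; split=> //; left.
  by move=> u e us' et eu; apply: nF; exists u => //; split=> //; right; exists e.
have {}nFu : ~ small [set t | A t /\ exists2 e, e \in d t & e \in d u].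
  move=> sm'; apply: nFu; apply: small_sub (smallU (small1 u) sm').
  by move=> t [At [->|td]]; [left | right].
have [|e _ ne] := @small_seq _ (fun e => [set t | A t /\ e \in d t])
    (enum_fset (d u)) _ nFu; last by exists e.
by move=> t [At [e et eu]]; exists e.
Qed.

(* Induction on a bound for the size of the domains: either greedily chosen
   members have disjoint domains, or the finitely many coordinates chosen so
   far meet a large subfamily, on which one coordinate can be fixed and
   discarded. *)
Lemma large_compatible n k (A : set T) (d : T -> {fset E}) :
  ~ small A ->
  (forall t, A t -> (#|` d t| <= k)%N) ->
  (forall t e, A t -> e \in d t -> h t e <> None) ->
  (forall t u e v w, A t -> A u -> h t e = Some v -> h u e = Some w ->
     v <> w -> e \in d t /\ e \in d u) ->
  exists s : seq T, [/\ uniq s, size s = n, (forall t, t \in s -> A t) &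
    forall t u, t \in s -> u \in s -> compatible (h t) (h u)].
Proof.
elim/ltn_ind: k A d => k IHk A d nA dk dh dinc.
have [[s [us sn sA sd]]|[e ne]] := disjoint_or_large_fiber n d nA.
  (* A disagreement at [e] would put [e] in both domains, which are disjoint unless [t = u]. *)
  exists s; split=> // t u ts us' e v w tv uw; apply: contrapT => vw.
  have [et eu] := dinc t u e v w (sA _ ts) (sA _ us') tv uw vw.
  by apply: vw; move: tv; rewrite (sd t u e) // uw => -[].
have [v [_ nv]] : exists v, W e v /\
    ~ small [set t | [/\ A t, e \in d t & h t e = Some v]].
  apply: contrapT => nov; apply: ne.
  apply: (@small_sub _ (\bigcup_(v in W e) [set t | [/\ A t, e \in d t & h t e = Some v]])).
    move=> t [At et]; case hte : (h t e) => [v|]; last by case: (dh t e At et).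
    by exists v; first exact: hW hte.
  by apply: small_bigcup => v Wv; apply: contrapT => nv; apply: nov; exists v.
case: k IHk dk => [|k] IHk dk.
  case: nv; apply: small_sub small0 => t [At et _]; move: (dk _ At).
  by rewrite leqn0 cardfs_eq0 => /eqP d0; rewrite d0 in et.
(* All members now agree at [e], so every disagreement survives the removal of [e] from the
   domains. *)
have [|||s [us sn sA sc]] := IHk k (ltnSn k)
    [set t | [/\ A t, e \in d t & h t e = Some v]] (fun t => d t `\ e)%fset nv => //.
- by move=> t [/dk + et _]; rewrite (cardfsD1 e) et.
- by move=> t e' [At _ _]; rewrite in_fsetD1 => /andP[_]; apply: dh.
- move=> t u e' w w' [At et tv] [Au eu uv] tw uw ww.
  have [e't e'u] := dinc t u e' w w' At Au tw uw ww.
  have e'e : e' != e.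
    by apply/eqP => e'e; apply: ww; move: tw uw; rewrite e'e tv uv => -[<-] [<-].
  by rewrite !in_fsetD1 e'e.
by exists s; split=> // t /sA[].
Qed.

End LargeFamilies.

(** * Density and compatibility in good triples *)

Lemma filter_seqI {I} {U : eqType} (D : set_system I) (B : U -> set I) (s : seq U) :
  Filter D -> (forall u, u \in s -> D (B u)) ->
  D [set x | forall u, u \in s -> B u x].
Proof.
move=> DF; elim: s => [|u s IHs] DB; first by apply: filterS filterT.
have Ds : D [set x | forall v, v \in s -> B v x].
  by apply: IHs => v vs; apply: DB; rewrite inE vs orbT.
apply: filterS (filterI (DB u (mem_head _ _)) Ds) => x [xu xs] v.
by rewrite inE => /predU1P[->|/xs].
Qed.

Section GoodFilters.
Context {disp : Order.disp_t} {O : orderType disp} {I : Type}.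
Variables (lam : O) (D : set_system I) (G : set (I -> O)).
Hypothesis D_good : good lam D G.

Lemma FI_empty : FI G (fun=> None).
Proof.
have p0 : pdom (fun _ : I -> O => None : option O) = set0.
  by apply/seteqP; split=> f.
by split=> //; rewrite p0 //; exact: finite_set0.
Qed.

(* Otherwise the filter generated by [D] and [~` A] would be pre-good and
   properly extend [D]. *)
Lemma good_dense A : ~ D (~` A) ->
  exists2 h, FI G h & D (~` (A_ h `&` ~` A)).
Proof.
have [[DP [X [DX Xfin]] DFI] Dmax] := D_good.
move=> DA; apply: contrapT => noh; apply: DA.
(* This is the filter generated by [D] and the complement of [A]. *)
pose D' := [set B | D (A `|` B)].
have noD' h : FI G h -> ~ D' (~` A_ h).
  move=> hFI D'h; apply: noh; exists h => //.
  by rewrite setCI setCK setUC.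
have D'F : Filter D'.
  split=> [|B C|B C BC]; rewrite /D' /=.
  - by rewrite setUT; exact: filterT.
  - by move=> /filterI/[apply]; rewrite -setUIr.
  - by apply: filterS; apply: setUS.
have DD' : D `<=` D' by move=> B; apply: filterS; apply: subsetUr.
(* An improper [D'] would contain the complement of [A_ h] for the empty [h]. *)
have D'P : ProperFilter D'.
  split=> // D'0; apply: (noD' _ FI_empty).
  by apply: filterS D'0.
have D'good : pre_good lam D' G.
  split=> //; exists X; split=> // i li; apply/DD'/DX => //.
rewrite -(Dmax D' D'good DD') /D' /= setUv; exact: filterT.
Qed.

(** If [g] is not yet in the domain of [h], giving it any value in its range only shrinks [A_ h]. *)
Lemma good_dense_at A g : G g -> ~ D (~` A) ->
  exists h, [/\ FI G h, D (~` (A_ h `&` ~` A)) & exists v, h g = Some v].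
Proof.
move=> Gg DA; have [h hFI hA] := good_dense DA.
case hg : (h g) => [v|]; first by exists h; split=> //; exists v.
have [x0] : exists x : I, True.
  apply: contrapT => noI; apply: DA.
  have [[DP _ _] _] := D_good.
  by apply: filterS filterT => x; case: noI; exists x.
pose h' f := if pselect (f = g) is left _ then Some (g x0) else h f.
have h'g : h' g = Some (g x0) by rewrite /h'; case: pselect.
have h'N f : f <> g -> h' f = h f by rewrite /h'; case: pselect.
exists h'; split; last by exists (g x0).
  have [hfin hG hr] := hFI; split.
  - apply: (@sub_finite_set _ _ (g |` pdom h)).
      move=> f; have [->|fg] := pselect (f = g); first by left.
      by rewrite /pdom /= h'N // => ?; right.
    by rewrite finite_setU; split=> //; apply: finite_set1.
  - move=> f; have [->//|fg] := pselect (f = g).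
    by rewrite /pdom /= h'N //; apply: hG.
  - move=> f a; have [->|fg] := pselect (f = g).
      by rewrite h'g => -[<-]; exists x0.
    by rewrite h'N //; apply: hr.
have [[DP _ _] _] := D_good.
apply: filterS hA; apply: subsetC => x [xh' xA]; split=> // f a hfa.
by apply: xh'; rewrite h'N // => fg; rewrite fg hg in hfa.
Qed.

(** The union [hU] of the finitely many [h t] is in [FI G], so its set is nonempty modulo [D] and is
    not covered by the null sets where [A_ (h t)] leaves [X t]. *)
Lemma good_compatible_meet {T : eqType} (s : seq T)
    (h : T -> (I -> O) -> option O) (X : T -> set I) :
  (forall t, t \in s -> FI G (h t) /\ D (~` (A_ (h t) `&` ~` X t))) ->
  (forall t u, t \in s -> u \in s -> compatible (h t) (h u)) ->
  exists x, forall t, t \in s -> A_ (h t) x /\ X t x.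
Proof.
move=> hs hc.
have [[DP _ DFI] _] := D_good.
pose P e w := exists2 t, t \in s & h t e = Some w.
pose hU e := if pselect (exists w, P e w) is left ex
  then Some (projT1 (cid ex)) else None.
have hUP e w : hU e = Some w <-> P e w.
  rewrite /hU; case: pselect => [ex|nex]; last first.
    by split=> // Pew; case: nex; exists w.
  case: cid => w' /= [t ts tw']; split=> [[<-]|[u us uw]]; first by exists t.
  by congr Some; apply: (hc t u ts us e).
have hUFI : FI G hU.
  split.
  - apply: (@sub_finite_set _ _ (\bigcup_(t in [set` s]) pdom (h t))).
      move=> e; rewrite /pdom /=; case hUe : (hU e) => [w|] // _.
      by have /hUP[t ts te] := hUe; exists t => //=; rewrite te.
    by apply: bigcup_finite => [|t ts]; [exact: finite_seq | case: (hs t ts) => -[]].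
  - move=> e; rewrite /pdom /=; case hUe : (hU e) => [w|] // _.
    have /hUP[t ts te] := hUe; have [[_ tG _] _] := hs t ts.
    by apply: tG; rewrite /pdom /= te.
  - by move=> e w /hUP[t ts te]; have [[_ _ tr] _] := hs t ts; apply: tr te.
apply: contrapT => nox; apply: (DFI _ hUFI).
have := filter_seqI (B := fun t => ~` (A_ (h t) `&` ~` X t)) DP
  (fun t ts => (hs t ts).2).
apply: filterS => x xs xU; apply: nox; exists x => t ts.
have xt : A_ (h t) x by move=> e w te; apply: xU; apply/hUP; exists t.
by split=> //; apply: contrapT => nX; apply: (xs t ts).
Qed.

(** The common core of both cases: only the closure of [small] under unions indexed by ranges of
    functions in [G] is used of the cardinals. *)
Lemma no_bounded_family (g : I -> O) (U : set_system I) {T : Type} (K : set T)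
    (small : set T -> Prop) :
  G g -> infinite_set (range g) -> ProperFilter U -> D `<=` U ->
  (forall A B, A `<=` B -> small B -> small A) ->
  small set0 -> (forall t, small [set t]) ->
  (forall f (F : O -> set T), G f ->
     (forall v, range f v -> small (F v)) ->
     small (\bigcup_(v in range f) F v)) ->
  ~ small K -> ~ has_bounded_family K U (fun s => nat_part (g s)).
Proof.
move=> Gg ginf UP DU small_sub small0 small1 small_bigcup nK [X [XU Xbd]].
have [v0 _] := infinite_setN0 ginf.
have /(card_le_ex v0)[j [jr jinj]] : [set: nat] #<= range g by apply/infiniteP.
(* The infinite range of [g] indexes countable unions through [j]; values not of the form [j n] get
   an empty piece. *)
have small_nat (F : nat -> set T) : (forall n, small (F n)) ->
    small (\bigcup_n F n).
  move=> Fs; pose F' v := [set t | exists2 n, j n = v & F n t].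
  apply: (@small_sub _ (\bigcup_(v in range g) F' v)).
    by move=> t [n _ Fnt]; exists (j n); [apply: jr | exists n].
  apply: small_bigcup => // v _.
  have [[n nv]|nov] := pselect (exists n, j n = v).
    by apply: small_sub (Fs n) => t [m]; rewrite -nv => /(jinj _ _ Logic.I Logic.I)->.
  by apply: small_sub small0 => t [n nv _]; case: nov; exists n.
have smallU A B : small A -> small B -> small (A `|` B).
  (* Index 0 gives [B]; every later index gives the default [A]. *)
  move=> sA sB; apply: (@small_sub _ (\bigcup_n nth A [:: B] n)).
    by move=> t [At|Bt]; [exists 1%N | exists 0%N].
  by apply: small_nat => -[|[|n]].
have /choice[h hP] t : exists h, FI G h /\ (K t ->
    D (~` (A_ h `&` ~` X t)) /\ exists v, h g = Some v).
  have [Kt|nKt] := pselect (K t); last first.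
    by exists (fun=> None); split=> //; apply: FI_empty.
  have [|h [hFI hX hg]] := @good_dense_at (X t) g Gg; last by exists h.
  move=> /DU DX; apply: (filter_not_empty U).
  by rewrite -(setICr (X t)); apply: filterI (XU t Kt) DX.
have hfin t : finite_set (pdom (h t)) by case: (hP t) => -[].
(* First thinning: the value at [g] is fixed. The size of the domain is fixed next. *)
have [v nKv] : exists v, ~ small [set t | K t /\ h t g = Some v].
  apply: contrapT => nov; apply: nK.
  apply: (@small_sub _ (\bigcup_(v in range g) [set t | K t /\ h t g = Some v])).
    move=> t Kt; have [[_ _ hr] /(_ Kt)[_ [v hv]]] := hP t.
    by exists v => //; apply: hr hv.
  by apply: small_bigcup => // v _; apply: contrapT => nv; apply: nov; exists v.
pose E : choiceType := {classic (I -> O)}.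
pose d t : {fset E} := fset_set (pdom (h t) : set E).
have dP t e : (e \in d t) = (e \in (pdom (h t) : set E)).
  by rewrite /d in_fset_set //; exact: hfin.
pose S k := [set t | [/\ K t, h t g = Some v & #|` d t| = k]].
have [k nSk] : exists k, ~ small (S k).
  apply: contrapT => nok; apply: nKv; apply: (@small_sub _ (\bigcup_k S k)).
    by move=> t [Kt tv]; exists #|` d t|.
  by apply: small_nat => k; apply: contrapT => nk; apply: nok; exists k.
(* The bound wherever [g] takes the value [v]; it is 0 when [v] is infinite, and [n.+1] compatible
   members still exceed it. *)
pose n := nat_part v.
have hW t (e : E) w : h t e = Some w -> [set w | G e /\ range e w] w.
  move=> te; have [[_ hG hr] _] := hP t; split; last exact: hr te.
  by apply: hG; rewrite /pdom /= te.
have [||||s [us sn sS sc]] := @large_compatible {classic T} E O small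
    (fun e => [set w | G e /\ range e w]) small_sub small0 small1 smallU _ h hW
    n.+1 k (S k) d nSk.
- move=> e F Fs; have [Ge|nGe] := pselect (G e); last first.
    by apply: small_sub small0 => t [w [/nGe]].
  apply: small_sub (small_bigcup e F Ge (fun w ew => Fs w (conj Ge ew))).
  by apply: bigcup_subset => w [].
- by move=> t [_ _ ->].
- by move=> t e _; rewrite dP => /set_mem.
- by move=> t u e w w' _ _ tw uw _; rewrite !dP; split; apply/mem_set;
    rewrite /pdom /= ?tw ?uw.
have [x xs] := @good_compatible_meet {classic T} s h X
  (fun t ts => conj (hP t).1 ((hP t).2 (let: And3 Kt _ _ := sS t ts in Kt)).1) sc.
case: s us sn sS sc xs => // t0 s us sn sS _ xs.
have gx : g x = v.
  have [xt0 _] := xs t0 (mem_head _ _).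
  by have [_ /xt0] := sS t0 (mem_head _ _).
have := Xbd x; rewrite gx -/n => bd.
(* The [n.+1] distinct entries of [s] index sets containing [x], one more than allowed. *)
suff : `I_n.+1 #<= [set i | K i /\ X i x].
  by move=> /card_le_trans/(_ bd); rewrite card_le_II ltnn.
apply: (@card_le_inj _ _ _ _ (nth t0 (t0 :: s))) => [i|i l] /=; rewrite -{1}sn => ilt.
  have mi := mem_nth t0 ilt; have [_ Xi] := xs _ mi.
  by have [Ki _ _] := sS _ mi.
by rewrite -sn => llt /eqP; rewrite nth_uniq // => /eqP.
Qed.

End GoodFilters.

(** * The two cases, by choice of the notion of smallness *)

Theorem claim5p1 (disp : Order.disp_t) (O : orderType disp)
    (O_wf : well_founded (fun x y : O => (x < y)%O))
    (lam mu : O)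
    (lam_card : is_infinite_cardinal lam) (mu_card : is_infinite_cardinal mu)
    (mu_le_lam : (mu <= lam)%O)
    (I : Type) (card_I : [set: I] #= below lam) :
  (forall (D : set_system I) (G : set (I -> O)) (g : I -> O),
     good_into lam mu D G -> G g -> infinite_set (range g) ->
     forall Dstar : set_system I, ultrafilter_above D g Dstar ->
     forall (T : Type) (mu_plus : set T),
       is_successor_cardinal (below mu) mu_plus ->
       ~ flexible mu_plus Dstar /\
       witnesses_not_flexible mu_plus Dstar (fun s => nat_part (g s)))
  /\
  (is_regular_cardinal mu ->
   forall (D : set_system I) (G : set (I -> O)) (g : I -> O),
     good_into_lt lam mu D G -> G g -> infinite_set (range g) ->
     forall Dstar : set_system I, ultrafilter_above D g Dstar ->
       ~ flexible (below mu) Dstar /\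
       witnesses_not_flexible (below mu) Dstar (fun s => nat_part (g s))).
Proof.
have not_flexible (T : Type) (K : set T) (D U : set_system I) (g : I -> O) :
    ultrafilter_above D g U ->
    ~ has_bounded_family K U (fun s => nat_part (g s)) ->
    ~ flexible K U /\ witnesses_not_flexible K U (fun s => nat_part (g s)).
  move=> [UU _ Ug] nbd.
  have large : eventually_large U (fun s => nat_part (g s)).
    by move=> n; apply: filterS (Ug n) => s [].
  by split=> // /(_ _ large).
have mu_inf := mu_card.2.
have [x0 mu_x0] := infinite_setN0 mu_inf.
split=> [D G g [D_good Gmu] Gg ginf U UDg T K [nK _]
        |mu_reg D G g [D_good Gmu] Gg ginf U UDg];
  apply: not_flexible (UDg) _; have [[UP _] DU _] := UDg.
(* Small means of size at most [mu]; ranges lie in [below mu], and a union of at most [mu] such sets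
   is again small. *)
- apply: (no_bounded_family D_good (small := fun S => S #<= below mu)) => //.
  + by move=> A B /subset_card_le; apply: card_le_trans.
  + by move=> t; apply: (card_le_inj (f := fun=> x0)) => // x y -> ->.
  + move=> f F Gf; apply: card_bigcup_le => //; apply: subset_card_le.
    by move=> _ [t _ <-]; apply: Gmu.
(* Small means of size less than [mu]; each range is an ordinal below [mu], so regularity gives
   closure under unions. *)
- apply: (no_bounded_family D_good (small := fun S => ~ (below mu #<= S))) => //.
  + by move=> A B /subset_card_le AB nB /card_le_trans/(_ AB).
  + by move=> /card_le_finite/(_ (finite_set0 _)).
  + by move=> t /card_le_finite/(_ (finite_set1 _)).
  + move=> f F Gf; have [a a_mu ->] := Gmu f Gf.
    exact: regular_bigcup.
Qed.
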